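(* There is an absolute constant $C$ such that for every $T\ge 3$, the algorithm BM-log run with $K=(T/\log T)^{1/3}$ (taken to be an integer $\ge2$) guarantees, against every oblivious adversary sequence $y_1,\dots,y_T\in\{0,1\}$, $$\mathsf{PKLCal}\le C\,T^{1/3}(\log T)^{2/3}.$$
   Context: Forecasting protocol: for $t=1,\dots,T$, the forecaster outputs a distribution $\mathcal{P}_t$ over a finite set $\mathcal{Z}\subset[0,1]$ and draws its prediction from it; simultaneously the adversary (which fixes $y_1,\dots,y_T$ in advance) chooses $y_t\in\{0,1\}$, then revealed. Log loss $\ell(w,y)=-y\log w-(1-y)\log(1-w)$. Bernoulli KL $\mathsf{KL}(q,p)=q\log\frac qp+(1-q)\log\frac{1-q}{1-p}$; $\tilde\rho_p=\frac{\sum_t y_t\mathcal{P}_t(p)}{\sum_t\mathcal{P}_t(p)}$ ($0/0=0$); $\mathsf{PKLCal}:=\sum_{p\in\mathcal{Z}}\sum_t\mathcal{P}_t(p)\mathsf{KL}(\tilde\rho_p,p)$. Algorithm BM-log with integer parameter $K\ge2$: $\mathcal{Z}=\{z_0,\dots,z_K\}$ with $z_0=\sin^2\frac{\pi}{4K}$, $z_i=\sin^2\frac{\pi i}{2K}$ ($1\le i\le K-1$), $z_K=\cos^2\frac{\pi}{4K}$. Rounding $\mathrm{RROUND}(w)$ for $w\in[0,1]$: if $w\in[z_i,z_{i+1})$ for some $i\in\{0,\dots,K-1\}$, output the distribution $q$ on $\mathcal{Z}$ with $q_i=\frac1D\frac{z_{i+1}-w}{z_{i+1}(1-z_{i+1})}$,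 $q_{i+1}=\frac1D\frac{w-z_i}{z_i(1-z_i)}$, $q_j=0$ otherwise, $D$ the normalizing constant; if $w<z_0$ output the point mass at $z_0$, if $w\ge z_K$ the point mass at $z_K$. At round $t$, for each $i\in\{0,\dots,K\}$ let $\mu_{t,i}(w)=\exp\big(-\sum_{\tau<t}\pi_{\tau,i}\,\ell(w,y_\tau)\big)$, $w_{t,i}=\frac{\int_0^1 w\mu_{t,i}(w)dw}{\int_0^1\mu_{t,i}(w)dw}$ and $q_{t,i}=\mathrm{RROUND}(w_{t,i})$. Let $Q_t$ be the $(K+1)\times(K+1)$ matrix with columns $q_{t,0},\dots,q_{t,K}$, compute a probability vector $\pi_t$ with $Q_t\pi_t=\pi_t$, output $\mathcal{P}_t(z_i)=\pi_{t,i}$, draw the prediction from $\mathcal{P}_t$, and observe $y_t$. *)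

(* Defs.v *)
From HB Require Import structures.
From mathcomp Require Import all_boot all_order all_algebra.
From mathcomp Require Import all_classical all_reals all_analysis.
Set Implicit Arguments. Unset Strict Implicit. Unset Printing Implicit Defensive.
Import Order.TTheory GRing.Theory Num.Theory.
Local Open Scope classical_set_scope.
Local Open Scope ring_scope.

Section BMlog.
Variable R : realType.

(* grid points z_0, ..., z_K  (indices >= K are mapped to z_K; only i <= K is used) *)
Definition zpt (K i : nat) : R :=
  if i == 0%N then sin (pi / (4 * K%:R)) ^+ 2
  else if (i < K)%N then sin (pi * i%:R / (2 * K%:R)) ^+ 2
  else cos (pi / (4 * K%:R)) ^+ 2.

Definition logloss (w : R) (y : bool) : R :=
  - ((nat_of_bool y)%:R * ln w) - (1 - (nat_of_bool y)%:R) * ln (1 - w).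

(* Bernoulli KL divergence (with ln 0 = 0, giving 0 log 0 = 0) *)
Definition KLb (q p : R) : R :=
  q * ln (q / p) + (1 - q) * ln ((1 - q) / (1 - p)).

(* RROUND(w) as a distribution on indices 0..K (value at index j) *)
Definition rround (K : nat) (w : R) (j : nat) : R :=
  let z := zpt K in
  if w < z 0%N then (j == 0%N)%:R
  else if z K <= w then (j == K)%:R
  else \sum_(i < K)
         (if (z i <= w) && (w < z i.+1) then
            let a := (z i.+1 - w) / (z i.+1 * (1 - z i.+1)) in
            let b := (w - z i) / (z i * (1 - z i)) in
            let D := a + b in
            (if j == i then a / D else if j == i.+1 then b / D else 0)
          else 0).

(* mu_{t,i}(w) = exp(- sum_{tau < t} pi_{tau,i} l(w, y_tau)) ; rounds are 0-indexed *)
Definition mu (y : nat -> bool) (pi_ : nat -> nat -> R) (t i : nat) (w : R) : R :=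
  expR (- \sum_(tau < t) pi_ tau i * logloss w (y tau)).

Definition wbar (y : nat -> bool) (pi_ : nat -> nat -> R) (t i : nat) : R :=
  Rintegral lebesgue_measure `[0%R, 1%R] (fun w => w * mu y pi_ t i w)
  / Rintegral lebesgue_measure `[0%R, 1%R] (fun w => mu y pi_ t i w).

(* pi_ t i = P_t(z_i): a run of BM-log with parameter K over T rounds
   (rounds t = 0..T-1) against the outcome sequence y. At every round the
   chosen pi_t is a probability vector that is a fixed point of Q_t, whose
   column i is RROUND(w_{t,i}). *)
Definition is_BMlog_run (T K : nat) (y : nat -> bool) (pi_ : nat -> nat -> R) : Prop :=
  forall t, (t < T)%N ->
    [/\ forall i, (i <= K)%N -> 0 <= pi_ t i,
        \sum_(i < K.+1) pi_ t i = 1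
      & forall j, (j <= K)%N ->
          \sum_(i < K.+1) rround K (wbar y pi_ t i) j * pi_ t i = pi_ t j].

(* rho~_{z_i} (with 0/0 = 0, as x / 0 = 0 in mathcomp) *)
Definition rho (T : nat) (y : nat -> bool) (pi_ : nat -> nat -> R) (i : nat) : R :=
  (\sum_(t < T) (nat_of_bool (y t))%:R * pi_ t i) / (\sum_(t < T) pi_ t i).

Definition PKLCal (T K : nat) (y : nat -> bool) (pi_ : nat -> nat -> R) : R :=
  \sum_(i < K.+1) \sum_(t < T) pi_ t i * KLb (rho T y pi_ i) (zpt K i).

End BMlog.

Definition Kchoice (R : realType) (T : nat) : nat :=
  maxn 2 (Num.truncn ((T%:R / ln (T%:R : R)) `^ (3%:R^-1) : R)).

(* Main.v *)
Require Import Defs.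
From HB Require Import structures.
From mathcomp Require Import all_boot all_order all_algebra.
From mathcomp Require Import all_classical all_reals all_analysis.
From mathcomp Require Import measurable_realfun ring lra.
Set Implicit Arguments. Unset Strict Implicit. Unset Printing Implicit Defensive.
Import Order.TTheory GRing.Theory Num.Theory numFieldNormedType.Exports.
Local Open Scope ring_scope.

(** Since [n KL(rho, z)] is the excess log loss of [z] over the empirical mean
    [rho], PKLCal is a swap regret.  The fixed point [Q pi = pi] turns the loss
    of the grid points into the expected loss of the rounded points RROUND(w),
    which exceeds the loss of [w] by O(1/K^2): the rounding weights cancel the
    first-order terms for both outcomes, and on the grid [sin^2] the squared
    spacing is O(1/K^2) times [z (1 - z)].  What is left is, for each column,
    the regret of the mixture forecaster with integral [F]: exp-concavity gives
    cumulative loss at most [- ln F], and bounding [F] below by its mass on an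
    interval of length 1/(n+1) near [rho] gives regret at most [ln (n+1) + 1].
    The total is O(T/K^2 + K ln T). *)

(** * Elementary logarithm inequalities and the log loss *)

Section LogLoss.
Variable R : realType.
Implicit Types (w x p : R) (y : bool).

Lemma ln_le_subr1 x : 0 < x -> ln x <= x - 1.
Proof.
by move=> x0; rewrite -{1}(subrK 1 x) addrC le_ln1Dx// ltrBrDl subrr.
Qed.

Lemma ln_le_expRM p x u : 0 < x -> 0 < u -> x <= expR p * u -> ln x <= p + ln u.
Proof.
move=> x0 u0; rewrite -ler_ln ?posrE ?mulr_gt0 ?expR_gt0//.
by rewrite lnM ?posrE ?expR_gt0// expRK.
Qed.

(** Bernoulli's inequality for [x ^ p], the power being written as an exponential. Applied to a
    ratio of likelihoods, it is the source of exp-concavity. *)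
Lemma powR_le_affine p x : 0 <= p <= 1 -> 0 < x ->
  expR (p * ln x) <= 1 + p * (x - 1).
Proof.
move=> /andP[p0 p1] x0; set u := 1 + p * (x - 1).
have u0 : 0 < u.
  have [p1E|pn1] := eqVneq p 1; first by rewrite /u p1E; lra.
  have {pn1}p1 : p < 1 by rewrite lt_neqAle pn1.
  rewrite /u; have : 0 <= p * x by rewrite mulr_ge0// ltW.
  by nra.
rewrite -[leRHS]lnK ?posrE// ler_expR.
(* Concavity of [ln], from [ln z <= z - 1] at [z = x / u] and [z = 1 / u]. *)
have h1 : ln x - ln u <= x / u - 1.
  by rewrite -ln_div ?posrE// ln_le_subr1// divr_gt0.
have h2 : - ln u <= u^-1 - 1.
  by rewrite -lnV ?posrE// ln_le_subr1// invr_gt0.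
have q0 : 0 <= 1 - p by rewrite subr_ge0.
have e : p * (x / u - 1) + (1 - p) * (u^-1 - 1) = 0.
  have -> : p * (x / u - 1) + (1 - p) * (u^-1 - 1) = (1 + p * (x - 1) - u) / u.
    by move: (u) u0 => v v0; field; rewrite gt_eqF.
  by rewrite subrr mul0r.
have := ler_wpM2l p0 h1; have := ler_wpM2l q0 h2; lra.
Qed.

(** The probability that forecast [w] gives to outcome [y]. It is affine in [w] and lets one
    argument serve both outcomes. *)
Definition lik w y : R := if y then w else 1 - w.

Lemma loglossE w y : logloss w y = - ln (lik w y).
Proof. by case: y; rewrite /logloss/= ?subrr ?subr0 !(mul0r, mul1r); lra. Qed.

Lemma lik_itv w y : 0 < w < 1 -> 0 < lik w y < 1.
Proof. by case: y => //=; lra. Qed.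

Lemma logloss_ge0 w y : 0 <= w <= 1 -> 0 <= logloss w y.
Proof. by move=> w01; rewrite loglossE oppr_ge0 ln_le0//; case: y => /=; lra. Qed.

Lemma measurable_lik y : measurable_fun [set: R] (fun w : R => lik w y).
Proof.
case: y => /=; first exact: measurable_id.
by apply: measurable_funB => //; exact: measurable_id.
Qed.

Lemma measurable_logloss y : measurable_fun [set: R] (@logloss R ^~ y).
Proof.
have -> : @logloss R ^~ y = (fun w => - ln (lik w y)).
  by apply/funext => w; exact: loglossE.
apply: measurable_funN; apply: measurableT_comp; first exact: measurable_ln.
exact: measurable_lik.
Qed.

End LogLoss.

(** * Integration over the unit interval *)

Section Integral01.
Variable R : realType.
Notation leb := (@lebesgue_measure R).
Local Notation I01 := (`[0%R, 1%R]%classic : set R).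

Lemma integrable01 (f : R -> R) (M : R) : measurable_fun [set: R] f ->
  (forall w, 0 <= w <= 1 -> `|f w| <= M) -> leb.-integrable I01 (EFin \o f).
Proof.
move=> mf fM; apply: measurable_bounded_integrable => //=.
- by rewrite lebesgue_measure_itv/= lte_fin ltr01 -EFinB ltry.
- exact: measurable_funTS.
- exists M; split; first exact: num_real.
  move=> x Mx w /=; rewrite in_itv/= => w01.
  by rewrite (le_trans (fM w w01))// ltW.
Qed.

(** Discarding the nonnegative integrand outside [[a, b]] serves both the positivity of the mixture
    integrals and the quantitative bound [mixture_lower]. *)
Lemma Rintegral01_ge_itv (f : R -> R) (a b c : R) :
  leb.-integrable I01 (EFin \o f) -> (forall w, 0 <= w <= 1 -> 0 <= f w) ->
  0 <= a -> a <= b -> b <= 1 -> (forall w, a <= w <= b -> c <= f w) ->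
  c * (b - a) <= Rintegral leb I01 f.
Proof.
move=> fi f0 a0 ab b1 fc.
have sub : (`[a, b]%classic `<=` I01)%classic.
  by move=> w /=; rewrite !in_itv/= => /andP[aw wb]; lra.
have fi' : leb.-integrable `[a, b]%classic (EFin \o f).
  by apply: integrableS fi.
have lab : leb `[a, b]%classic = (b - a)%:E.
  rewrite lebesgue_measure_itv/= lte_fin.
  by case: ltgtP ab => // -> _; rewrite subrr.
apply: (@le_trans _ _ (Rintegral leb `[a, b]%classic f)).
  have -> : c * (b - a) = Rintegral leb `[a, b]%classic (fun=> c).
    by rewrite Rintegral_cst//= lab.
  apply: le_Rintegral => //.
  apply: (@measurable_bounded_integrable _ _ _ leb (fun=> c)) => //=.
    by rewrite lab ltry.
  exact: bounded_cst.
rewrite /Rintegral fine_le//.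
- exact: integrable_fin_num.
- exact: integrable_fin_num.
- apply: ge0_subset_integral => //.
  by case/integrableP: fi.
Qed.

Lemma integrable01Zl k (f : R -> R) : leb.-integrable I01 (EFin \o f) ->
  leb.-integrable I01 (EFin \o (fun w => k * f w)).
Proof.
by move=> fi; apply: eq_integrable (integrableZl _ k fi).
Qed.

Lemma integrable01D (f g : R -> R) :
  leb.-integrable I01 (EFin \o f) -> leb.-integrable I01 (EFin \o g) ->
  leb.-integrable I01 (EFin \o (fun w => f w + g w)).
Proof.
by move=> fi gi; apply: eq_integrable (integrableD _ fi gi).
Qed.

End Integral01.

(** * Regret of the mixture forecaster in one column *)

Section Mixture.
Variables (R : realType) (y : nat -> bool) (pi_ : nat -> nat -> R) (i : nat).
Notation leb := (@lebesgue_measure R).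
Local Notation I01 := (`[0%R, 1%R]%classic : set R).
Local Notation F t := (Rintegral leb I01 (fun w => mu y pi_ t i w)).

Lemma mu_gt0 t w : 0 < mu y pi_ t i w. Proof. exact: expR_gt0. Qed.

Lemma measurable_mu t : measurable_fun [set: R] (mu y pi_ t i).
Proof.
apply: measurableT_comp; first exact: measurable_expR.
apply: measurable_funN; apply: measurable_sum => tau.
by apply: measurable_funM => //; exact: measurable_logloss.
Qed.

Lemma muS t w : mu y pi_ t.+1 i w =
  expR (- (pi_ t i * logloss w (y t))) * mu y pi_ t i w.
Proof. by rewrite /mu big_ord_recr/= opprD expRD mulrC. Qed.

Section Bounded.
Variable t : nat.
Hypothesis pi01 : forall tau, (tau < t)%N -> 0 <= pi_ tau i <= 1.

Lemma mu_le1 w : 0 <= w <= 1 -> mu y pi_ t i w <= 1.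
Proof.
move=> w01; rewrite -expR0 ler_expR oppr_le0 sumr_ge0// => tau _.
by rewrite mulr_ge0 ?logloss_ge0//; case/andP: (pi01 (ltn_ord tau)).
Qed.

Lemma integrable_mulr_mu (g : R -> R) (M : R) : measurable_fun [set: R] g ->
  (forall w, 0 <= w <= 1 -> `|g w| <= M) ->
  leb.-integrable I01 (EFin \o (fun w => g w * mu y pi_ t i w)).
Proof.
move=> mg gM; apply: (@integrable01 _ _ M).
  by apply: measurable_funM => //; exact: measurable_mu.
move=> w w01; rewrite normrM (gtr0_norm (mu_gt0 _ _)) -[leRHS]mulr1.
by rewrite ler_pM ?gM ?mu_le1// ltW// mu_gt0.
Qed.

Lemma integrable_mu : leb.-integrable I01 (EFin \o mu y pi_ t i).
Proof.
have -> : mu y pi_ t i = (fun w => 1 * mu y pi_ t i w).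
  by apply/funext => w; rewrite mul1r.
by apply: (integrable_mulr_mu (g := fun=> 1) (M := 1)) => // w _; rewrite normr1.
Qed.

Lemma integrable_likmu z :
  leb.-integrable I01 (EFin \o (fun w => lik w z * mu y pi_ t i w)).
Proof.
apply: (integrable_mulr_mu (M := 1)); first exact: measurable_lik.
by move=> w w01; rewrite ler_norml /lik; case: z; lra.
Qed.

(** On the middle half both likelihoods are at least 1/4, so round [tau] costs at most
    [pi_ tau i * ln 4]. This keeps the mixture integrals positive. *)
Lemma mu_bulk : exists2 c, 0 < c &
  forall w, 4^-1 <= w <= 3 / 4 -> c <= mu y pi_ t i w.
Proof.
exists (expR (- \sum_(tau < t) pi_ tau i * ln 4)); first exact: expR_gt0.
move=> w w13; rewrite ler_expR lerN2 ler_sum// => tau _.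
have /andP[p0 _] := pi01 (ltn_ord tau).
rewrite ler_wpM2l// loglossE lerNl -lnV ?posrE; last lra.
have h : 4^-1 <= lik w (y tau) by case: (y tau) => /=; lra.
by rewrite ler_ln ?posrE//; lra.
Qed.

Lemma Rintegral_likmu_gt0 z :
  0 < Rintegral leb I01 (fun w => lik w z * mu y pi_ t i w).
Proof.
have [c c0 cP] := mu_bulk.
apply: (@lt_le_trans _ _ ((4^-1 * c) * (3 / 4 - 4^-1))).
  by rewrite !mulr_gt0//; lra.
apply: Rintegral01_ge_itv; last first.
- move=> w w13; have := cP w w13; have : 4^-1 <= lik w z by case: z => /=; lra.
  by nra.
- lra.
- lra.
- lra.
- move=> w w01; rewrite mulr_ge0 ?(ltW (mu_gt0 _ _))//.
  by case: z => /=; lra.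
- exact: integrable_likmu.
Qed.

Lemma mixture_gt0 : 0 < F t.
Proof.
have [c c0 cP] := mu_bulk.
apply: (@lt_le_trans _ _ (c * (3 / 4 - 4^-1))).
  by rewrite !mulr_gt0//; lra.
apply: Rintegral01_ge_itv cP; try lra.
- exact: integrable_mu.
- by move=> w _; rewrite ltW// mu_gt0.
Qed.

(** Since [lik] is affine, the likelihood of the mean is the mean of the likelihoods under the
    density proportional to [mu]. *)
Lemma lik_wbar z : lik (wbar y pi_ t i) z =
  Rintegral leb I01 (fun w => lik w z * mu y pi_ t i w) / F t.
Proof.
case: z => //=; under eq_Rintegral do rewrite mulrBl mul1r.
rewrite RintegralB//; [|exact: integrable_mu|exact: (integrable_likmu true)].
by rewrite mulrBl divff// gt_eqF// mixture_gt0.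
Qed.

Lemma lik_wbar_gt0 z : 0 < lik (wbar y pi_ t i) z.
Proof. by rewrite lik_wbar divr_gt0 ?Rintegral_likmu_gt0 ?mixture_gt0. Qed.

Lemma wbar_itv : 0 < wbar y pi_ t i < 1.
Proof. by have := lik_wbar_gt0 true; have := lik_wbar_gt0 false => /=; lra. Qed.

End Bounded.

(* Exp-concavity of the log loss, i.e. Jensen's inequality for [w ^ pi]. *)
Lemma mixture_step t : (forall tau, (tau < t.+1)%N -> 0 <= pi_ tau i <= 1) ->
  F t.+1 <= expR (- (pi_ t i * logloss (wbar y pi_ t i) (y t))) * F t.
Proof.
move=> pi01S.
have pi01 tau : (tau < t)%N -> 0 <= pi_ tau i <= 1.
  by move=> h; apply: pi01S; rewrite ltnS ltnW.
have pt := pi01S t (ltnSn t).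
set p := pi_ t i in pt *; set wb := wbar y pi_ t i; set z := y t.
have L0 : 0 < lik wb z := lik_wbar_gt0 pi01 z.
set L := lik wb z in L0.
have int_lik := integrable_likmu pi01 z.
(* On the open interval [G] is Bernoulli's upper bound for [mu] at [t.+1], with ratio [lik w z / L].
   Its integral is exactly [L ^ p * F t], because that ratio has mean 1 by [lik_wbar]. *)
pose G w := expR (p * ln L) * ((1 - p) * mu y pi_ t i w + p / L * (lik w z * mu y pi_ t i w)).
have int1 := integrable01Zl (1 - p) (integrable_mu pi01).
have int2 := integrable01Zl (p / L) int_lik.
have intS := integrable01D int1 int2.
have intG : leb.-integrable I01 (EFin \o G) := integrable01Zl (expR (p * ln L)) intS.
have -> : expR (- (p * logloss wb z)) * F t = Rintegral leb I01 G.
  rewrite /G RintegralZl//.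
  rewrite RintegralD// (RintegralZl _ _ (integrable_mu pi01))//.
  rewrite RintegralZl// loglossE mulrN opprK -/L.
  have -> : Rintegral leb I01 (fun w => lik w z * mu y pi_ t i w) = L * F t.
    by rewrite /L lik_wbar// divfK// gt_eqF// mixture_gt0.
  by congr (_ * _); field; rewrite gt_eqF.
have sub : (`]0%R, 1%R[%classic `<=` I01)%classic.
  by move=> w /=; rewrite !in_itv/= => /andP[aw wb']; lra.
have open01 f : leb.-integrable I01 (EFin \o f) ->
    Rintegral leb I01 f = Rintegral leb `]0%R, 1%R[%classic f.
  move=> fi.
  rewrite (@Rintegral_itv_bndo_bndc R (BRight 0) 1 f); last exact: integrableS fi.
  rewrite Rintegral_itv_obnd_cbnd//; apply: integrableS fi => //.
  by move=> w /=; rewrite !in_itv/=; lra.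
have intF := integrable_mu pi01S.
(* The endpoints are excluded because there [ln 0 = 0] breaks the inequality. *)
rewrite (open01 _ intG) (open01 _ intF); apply: le_Rintegral => //.
- exact: integrableS intF.
- exact: integrableS intG.
move=> w; rewrite /= in_itv/= => w01.
rewrite -[leLHS]/(mu y pi_ t.+1 i w) muS -/p -/z.
have -> : expR (p * ln L) * ((1 - p) * mu y pi_ t i w + p / L * (lik w z * mu y pi_ t i w)) =
   expR (p * ln L) * (1 + p * (lik w z / L - 1)) * mu y pi_ t i w by field; rewrite gt_eqF.
rewrite ler_wpM2r ?(ltW (mu_gt0 _ _))// loglossE mulrN opprK.
have /andP[l0 _] := lik_itv z w01.
have -> : p * ln (lik w z) = p * ln L + p * ln (lik w z / L).
  by rewrite ln_div ?posrE//; ring.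
by rewrite expRD ler_pM2l ?expR_gt0// powR_le_affine// divr_gt0.
Qed.

(** Telescoping: [F] starts at 1, and by [mixture_step] the loss of each round is at most the drop
    of [ln F]. *)
Lemma regret_mixture t : (forall tau, (tau < t)%N -> 0 <= pi_ tau i <= 1) ->
  \sum_(tau < t) pi_ tau i * logloss (wbar y pi_ tau i) (y tau) <= - ln (F t).
Proof.
elim: t => [_|t IH pi01].
  rewrite big_ord0 (_ : F 0 = 1) ?ln1 ?oppr0//.
  under eq_Rintegral do rewrite /mu big_ord0 oppr0 expR0.
  by rewrite Rintegral_cst//= lebesgue_measure_itv/= lte_fin ltr01 oppr0 adde0 mul1r.
have pi01' tau : (tau < t)%N -> 0 <= pi_ tau i <= 1.
  by move=> h; apply: pi01; rewrite ltnS ltnW.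
have h := ln_le_expRM (mixture_gt0 pi01) (mixture_gt0 pi01') (mixture_step pi01).
rewrite big_ord_recr/= lerNr opprD addrC; apply: (le_trans h).
by rewrite lerD2l lerNr; exact: IH.
Qed.

Section LowerBound.
Variable t : nat.
Hypothesis pi01 : forall tau, (tau < t)%N -> 0 <= pi_ tau i <= 1.
Let n : R := \sum_(tau < t) pi_ tau i.
Let a : R := \sum_(tau < t) (nat_of_bool (y tau))%:R * pi_ tau i.
Let r : R := a / n.

Lemma mass_ge0 : 0 <= n.
Proof. by apply: sumr_ge0 => tau _; case/andP: (pi01 (ltn_ord tau)). Qed.

Lemma hits_itv : 0 <= a <= n.
Proof.
apply/andP; split; [apply: sumr_ge0|apply: ler_sum] => tau _;
  have := pi01 (ltn_ord tau); by case: (y tau) => /=; lra.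
Qed.

Lemma sum_logloss w :
  \sum_(tau < t) pi_ tau i * logloss w (y tau) = - (a * ln w + (n - a) * ln (1 - w)).
Proof.
rewrite /a /n -sumrB !mulr_suml -big_split/= -sumrN.
by apply: eq_bigr => tau _; rewrite loglossE; case: (y tau) => /=; ring.
Qed.

(* On the interval [(1-e) r, (1-e) r + e], with [e = 1/(n+1)], both likelihoods
   are at least [1 - e] times those of [r], and [(1-e)^n >= exp (-1)]. *)
Lemma mixture_lower :
  - ln (F t) <= - (a * ln r + (n - a) * ln (1 - r)) + ln (n + 1) + 1.
Proof.
have n0 := mass_ge0; have /andP[a0 an] := hits_itv.
have n1 : 0 < n + 1 by lra.
pose e := (n + 1)^-1.
have e0 : 0 < e by rewrite invr_gt0.
have e1 : e <= 1 by rewrite invf_le1//; lra.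
have r0 : 0 <= r by rewrite divr_ge0.
have r1 : r <= 1.
  rewrite /r; have [->|nn] := eqVneq n 0; first by rewrite invr0 mulr0.
  by rewrite ler_pdivrMr ?mul1r// lt0r nn.
pose E := a * ln r + (n - a) * ln (1 - r).
have key : expR (n * ln (1 - e) + E) * e <= F t.
  have eE : e = ((1 - e) * r + e) - ((1 - e) * r) by ring.
  rewrite [X in _ * X <= _]eE.
  have r1e : 0 <= (1 - e) * r by rewrite mulr_ge0//; lra.
  have r2e : (1 - e) * r <= 1 - e by rewrite ler_piMr//; lra.
  apply: Rintegral01_ge_itv => //; try lra.
  - exact: integrable_mu.
  - by move=> w _; rewrite ltW// mu_gt0.
  move=> w /andP[w0 w1]; rewrite ler_expR sum_logloss opprK.
  (* When [n = 0], [e] is 1 and [ln (1 - e)] is only a default value, so this case is separate; both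
     sides vanish. *)
  have [nz|nn] := eqVneq n 0.
    have az : a = 0 by lra.
    by rewrite /E az nz; lra.
  have ep : 0 < 1 - e.
    rewrite subr_gt0 invf_lt1//; have : 0 < n by rewrite lt0r nn.
    lra.
  (* When [r] is 0 or 1, one of the [q] is 0 and its logarithm is a default value; the weight [s] is
     then 0 as well. *)
  have side s q x : 0 <= s -> (s != 0 -> 0 < q) -> (1 - e) * q <= x ->
      s * ln (1 - e) + s * ln q <= s * ln x.
    move=> s0 q0 qx; have [->|sn] := eqVneq s 0; first by rewrite !mul0r addr0.
    have qp := q0 sn; have eq0 : 0 < (1 - e) * q by rewrite mulr_gt0.
    rewrite -mulrDr -lnM ?posrE// ler_wpM2l// ler_ln ?posrE//.
    exact: lt_le_trans qx.
  have h1 : a * ln (1 - e) + a * ln r <= a * ln w.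
    by apply: side => // an0; rewrite divr_gt0// lt0r ?an0 ?nn.
  have h2 : (n - a) * ln (1 - e) + (n - a) * ln (1 - r) <= (n - a) * ln (1 - w).
    apply: side; first lra.
    - move=> bn0; have -> : 1 - r = (n - a) / n by rewrite /r; field.
      by rewrite divr_gt0// lt0r ?bn0 ?nn//; lra.
    - by lra.
  by rewrite /E; lra.
have F0 := mixture_gt0 pi01.
have lnF : n * ln (1 - e) + E - ln (n + 1) <= ln (F t).
  rewrite -lnV ?posrE// -/e -[X in X + ln e]expRK -lnM ?posrE ?expR_gt0//.
  by rewrite ler_ln ?posrE// mulr_gt0 ?expR_gt0.
have : - 1 <= n * ln (1 - e).
  have [->|nn] := eqVneq n 0; first by rewrite mul0r; lra.
  have np : 0 < n by rewrite lt0r nn.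
  have -> : 1 - e = ((n + 1) / n)^-1.
    by rewrite /e; field; rewrite gt_eqF// gt_eqF.
  rewrite lnV ?posrE ?divr_gt0// mulrN lerN2.
  have h := @ln_le_subr1 R ((n + 1) / n) (divr_gt0 n1 np).
  apply: (le_trans (ler_wpM2l n0 h)).
  have -> : n * ((n + 1) / n - 1) = 1 by field.
  by [].
by rewrite -/E; lra.
Qed.

(** By [sum_logloss] the second summand is minus the loss of the constant [r], so this is the regret
    against the empirical mean. *)
Lemma regret_column :
  \sum_(tau < t) pi_ tau i * logloss (wbar y pi_ tau i) (y tau)
    + (a * ln r + (n - a) * ln (1 - r)) <= ln (n + 1) + 1.
Proof.
by have := regret_mixture pi01; have := mixture_lower; lra.
Qed.

End LowerBound.
End Mixture.

(** * Sine inequalities for the grid spacing *)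

Section Trigonometry.
Variable R : realType.
Implicit Types x y a b : R.

(** The difference is [2 cos ((x + y) / 2) sin ((y - x) / 2)]. Assuming [x + y <= pi] instead of
    [y <= pi / 2] admits doubled angles beyond [pi / 2]. *)
Lemma sin_ler x y : 0 <= x -> x <= y -> x + y <= pi -> sin x <= sin y.
Proof.
move=> x0 xy xyp.
have -> : sin x = sin ((x + y) / 2 - (y - x) / 2) by congr sin; lra.
have -> : sin y = sin ((x + y) / 2 + (y - x) / 2) by congr sin; lra.
rewrite sinB sinD -subr_ge0.
have -> : forall p q r s : R, p * q + r * s - (p * q - r * s) = 2 * (r * s).
  by move=> *; ring.
by rewrite !mulr_ge0 ?cos_ge0_pihalf ?sin_ge0_pi//; lra.
Qed.

Lemma sin_le_id x : 0 <= x -> sin x <= x.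
Proof.
move=> x0.
have [|z _] := @MVT_segment _ sin cos _ _ x0.
  exact/continuous_subspaceT/continuous_sin.
rewrite sin0 !subr0 => ->.
by rewrite ler_piMl// cos_le1.
Qed.

(* [sin b ^ 2 - sin a ^ 2 = sin (b - a) * sin (b + a)], and
   [sin (a + b) <= sin (2 a) + sin (b - a) <= 2 * sin (2 a)]; likewise at [b]. *)
Lemma sin2_gap a b : a <= b -> b - a <= 2 * a -> b - a <= pi - 2 * b ->
  (sin b ^+ 2 - sin a ^+ 2) ^+ 2 <= sin (b - a) ^+ 2 * (16 * (sin a ^+ 2 * (1 - sin a ^+ 2)))
  /\ (sin b ^+ 2 - sin a ^+ 2) ^+ 2 <= sin (b - a) ^+ 2 * (16 * (sin b ^+ 2 * (1 - sin b ^+ 2))).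
Proof.
move=> ab da db.
have -> : sin b ^+ 2 - sin a ^+ 2 = sin (b - a) * sin (b + a).
  rewrite sinB sinD.
  have := cos2Dsin2 a; have := cos2Dsin2 b.
  move: (cos a) (cos b) (sin a) (sin b) => ca cb sa sb hb ha.
  have -> : (sb * ca - cb * sa) * (sb * ca + cb * sa) = sb ^+ 2 * ca ^+ 2 - cb ^+ 2 * sa ^+ 2 by ring.
  have -> : ca ^+ 2 = 1 - sa ^+ 2 by lra.
  have -> : cb ^+ 2 = 1 - sb ^+ 2 by lra.
  by ring.
have dbl x : sin (2 * x) ^+ 2 = 4 * (sin x ^+ 2 * (1 - sin x ^+ 2)).
  have -> : 2 * x = x *+ 2 by rewrite mulr_natl.
  by rewrite sin_mulr2n -cos2sin2; ring.
have s0 : 0 <= sin (b + a) by rewrite sin_ge0_pi//; lra.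
have d0 : 0 <= sin (b - a) by rewrite sin_ge0_pi//; lra.
have step c e : 0 <= sin c -> sin (b + a) = sin c * cos e + cos c * sin e ->
    `|sin e| <= sin c ->
    (sin (b - a) * sin (b + a)) ^+ 2 <= sin (b - a) ^+ 2 * (4 * sin c ^+ 2).
  move=> c0 se le; rewrite exprMn ler_wpM2l ?sqr_ge0//.
  have -> : 4 * sin c ^+ 2 = (2 * sin c) ^+ 2 by ring.
  rewrite ler_sqr ?nnegrE//; last lra.
  rewrite se.
  have h1 : sin c * cos e <= sin c by rewrite ler_piMr// cos_le1.
  have h2 : cos c * sin e <= sin c.
    apply: le_trans le; rewrite (le_trans (ler_norm _))// normrM.
    by rewrite ler_piMl// cos_max.
  by lra.
have Ha : sin (b - a) <= sin (2 * a) by apply: sin_ler; lra.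
have Hb : sin (b - a) <= sin (2 * b) by apply: sin_ler; lra.
split.
- have -> : 16 * (sin a ^+ 2 * (1 - sin a ^+ 2)) = 4 * sin (2 * a) ^+ 2 by rewrite dbl; ring.
  apply: (step (2 * a) (b - a)); first lra.
  + by rewrite -sinD; congr sin; ring.
  + by rewrite ger0_norm.
- have -> : 16 * (sin b ^+ 2 * (1 - sin b ^+ 2)) = 4 * sin (2 * b) ^+ 2 by rewrite dbl; ring.
  apply: (step (2 * b) (a - b)); first lra.
  + by rewrite -sinD; congr sin; ring.
  + by rewrite -opprB sinN normrN ger0_norm.
Qed.

End Trigonometry.

(** * Rounding loss on the [sin^2] grid *)

Section Rounding.
Variable R : realType.
Implicit Types (z w m : R) (y : bool).

(* [a] and [b] are chosen so that the first-order terms in the expansion of the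
   loss at [w] cancel up to [(w - z0) (z1 - w) (z1 - z0)], for both outcomes. *)
Lemma round_excess z0 z1 w m y :
  let a := (z1 - w) / (z1 * (1 - z1)) in let b := (w - z0) / (z0 * (1 - z0)) in
  0 < z0 -> z0 <= w -> w < z1 -> z1 < 1 ->
  0 < m -> m <= z0 * (1 - z0) -> m <= z1 * (1 - z1) ->
  a / (a + b) * logloss z0 y + b / (a + b) * logloss z1 y
    <= logloss w y + (z1 - z0) ^+ 2 / (4 * m).
Proof.
move=> a b p0 zw wz q1 m0 mB mA.
have z10 : 0 < z1 by lra.
have w0 : 0 < w by lra.
set A := z1 * (1 - z1) in mA a *; set B := z0 * (1 - z0) in mB b *.
have A0 : 0 < A by lra.
have B0 : 0 < B by lra.
have a0 : 0 < a by rewrite divr_gt0//; lra.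
have b0 : 0 <= b by rewrite divr_ge0//; lra.
have D0 : 0 < a + b by lra.
have -> : a / (a + b) * logloss z0 y + b / (a + b) * logloss z1 y
   = (a * logloss z0 y + b * logloss z1 y) / (a + b) by ring.
rewrite ler_pdivrMr//.
have lnle (u v : R) : 0 < u -> 0 < v -> ln u - ln v <= u / v - 1.
  by move=> u0 v0; rewrite -ln_div ?posrE// ln_le_subr1// divr_gt0.
(* [S] is what the two tangent bounds [ln u - ln v <= u / v - 1] add up to, the same value for
   either outcome. *)
pose S := (w - z0) * (z1 - w) * (z1 - z0) / (A * B).
have e1 : a * (logloss z0 y - logloss w y) + b * (logloss z1 y - logloss w y) <= S.
  case: y; rewrite !loglossE /= !opprK ![- _ + _]addrC.
  - have := lnle w z0 w0 p0; have := lnle w z1 w0 z10.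
    move/(ler_wpM2l b0) => h1 /(ler_wpM2l (ltW a0)) h0.
    apply: (le_trans (lerD h0 h1)).
    have -> : a * (w / z0 - 1) + b * (w / z1 - 1) = S; last by [].
    by rewrite /a /b /S /A /B; field; rewrite !gt_eqF//; lra.
  - have w1 : 0 < 1 - w by lra.
    have u1 : 0 < 1 - z0 by lra.
    have v1 : 0 < 1 - z1 by lra.
    have := lnle (1 - w) (1 - z0) w1 u1; have := lnle (1 - w) (1 - z1) w1 v1.
    move/(ler_wpM2l b0) => h1 /(ler_wpM2l (ltW a0)) h0.
    apply: (le_trans (lerD h0 h1)).
    have -> : a * ((1 - w) / (1 - z0) - 1) + b * ((1 - w) / (1 - z1) - 1) = S; last by [].
    by rewrite /a /b /S /A /B; field; rewrite !gt_eqF//; lra.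
(* By AM-GM [(w - z0) (z1 - w) <= (z1 - z0)^2 / 4], and [(a + b) A B >= m (z1 - z0)] as [m] is below
   both [A] and [B]. *)
have e2 : S <= (z1 - z0) ^+ 2 / (4 * m) * (a + b).
  have -> : (z1 - z0) ^+ 2 / (4 * m) * (a + b) =
     ((z1 - z0) ^+ 2 / (4 * m) * ((z1 - w) * B + (w - z0) * A)) / (A * B).
    by rewrite /a /b; field; rewrite !gt_eqF.
  rewrite /S ler_pM2r ?invr_gt0 ?(mulr_gt0 A0 B0)//.
  apply: (@le_trans _ _ ((z1 - z0) ^+ 2 / (4 * m) * (m * (z1 - z0)))).
    have -> : (z1 - z0) ^+ 2 / (4 * m) * (m * (z1 - z0)) = (z1 - z0) ^+ 2 / 4 * (z1 - z0).
      by field; rewrite gt_eqF.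
    rewrite ler_wpM2r//; first lra.
    by have := sqr_ge0 ((w - z0) - (z1 - w)); nra.
  rewrite ler_wpM2l ?divr_ge0 ?sqr_ge0//; first lra.
  have h1 : (z1 - w) * m <= (z1 - w) * B by rewrite ler_wpM2l//; lra.
  have h2 : (w - z0) * m <= (w - z0) * A by rewrite ler_wpM2l//; lra.
  lra.
by have := le_trans e1 e2; rewrite !mulrDl !mulrBr; lra.
Qed.

Lemma sum_delta n i (f : nat -> R) : (i < n)%N ->
  \sum_(j < n) (j == i :> nat)%:R * f j = f i.
Proof.
move=> lin; rewrite (bigD1 (Ordinal lin))//= eqxx mul1r big1 ?addr0// => j.
by rewrite -val_eqE /= => /negbTE ->; rewrite mul0r.
Qed.

Section Grid.
Variables (K : nat) (h : R).
Hypotheses (K2 : (2 <= K)%N) (hE : h = pi / (4 * K%:R)).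

(** The angles of the grid: interior ones are multiples of [2 h], and the two extreme ones lie [h]
    inside [0] and [pi / 2], since [cos h = sin (pi / 2 - h)]. *)
Definition theta i : R :=
  if i == 0%N then h
  else if (i < K)%N then pi * i%:R / (2 * K%:R)
  else pi / 2 - h.

Let K0 : 0 < K%:R :> R. Proof. by rewrite ltr0n (leq_trans _ K2). Qed.
Let h0 : 0 < h. Proof. by rewrite hE divr_gt0 ?pi_gt0// mulr_gt0. Qed.
Let piE : pi = 4 * h * K%:R. Proof. by rewrite hE; field; rewrite gt_eqF. Qed.
Let K2r : 2 <= K%:R :> R. Proof. by rewrite ler_nat. Qed.

Lemma zptE i : zpt R K i = sin (theta i) ^+ 2.
Proof.
rewrite /zpt /theta -hE; case: ifP => // _; case: ifP => // _.
by rewrite -[pi / 2 - _]opprB sinN sinBpihalf opprK.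
Qed.

(** The steps are [2 h] in the interior and [h] at both ends. *)
Lemma theta_step i : (i < K)%N -> 0 < theta i.+1 - theta i <= 2 * h.
Proof.
move=> iK; have hpos := h0; have K2r' := K2r; rewrite /theta piE /=.
have e j : 4 * h * K%:R * j%:R / (2 * K%:R) = 2 * h * j%:R.
  by field; rewrite gt_eqF.
rewrite !e iK; case: i iK => [|i] iK /=.
  by rewrite K2 mulr1; lra.
case: ltnP => Hi.
  by rewrite -[in X in _ * X - _](addn1 i.+1) natrD; lra.
have -> : i.+1%:R = K%:R - 1 :> R.
  have -> : K = i.+2 by apply/eqP; rewrite eqn_leq Hi iK.
  by rewrite -[in RHS](addn1 i.+1) natrD addrK.
lra.
Qed.

(** A distance [h] from [0] and [pi / 2], against steps of at most [2 h], is what the hypotheses of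
    [sin2_gap] ask for. *)
Lemma theta_itv i : h <= theta i <= pi / 2 - h.
Proof.
have hpos := h0.
have h2K : 2 * h <= h * K%:R by rewrite mulrC ler_wpM2l// ltW.
rewrite /theta piE.
case: i => [|i] /=; first lra.
case: ifP => [iK|_]; last lra.
have -> : 4 * h * K%:R * i.+1%:R / (2 * K%:R) = 2 * h * i.+1%:R.
  by field; rewrite gt_eqF.
have i1 : 1 <= i.+1%:R :> R by rewrite ler1n.
have iK' : i.+1%:R + 1 <= K%:R :> R by rewrite natr1 ler_nat.
have := ler_wpM2l (ltW h0) i1; have := ler_wpM2l (ltW h0) iK'; lra.
Qed.

Lemma h_le : h <= K%:R^-1 /\ h <= 2^-1.
Proof.
have p4 : pi <= 4 :> R by have := @pihalf_lt2 R; lra.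
have hK : h <= K%:R^-1.
  by rewrite hE ler_pdivrMr ?mulr_gt0// mulrCA mulVf ?gt_eqF// mulr1.
split=> //; apply: (le_trans hK); by rewrite lef_pV2 ?posrE.
Qed.

Lemma zpt_itv i : 0 < zpt R K i < 1.
Proof.
have /andP[t0 t1] := theta_itv i.
have hpos := h0; rewrite zptE.
have s0 : 0 < sin (theta i) by rewrite sin_gt0_pi//; have := @pi_gt0 R; lra.
have c0 : 0 < cos (theta i) by rewrite cos_gt0_pihalf//; lra.
rewrite exprn_gt0//= sin2cos2; have : 0 < cos (theta i) ^+ 2 by rewrite exprn_gt0.
lra.
Qed.

Lemma zpt_step i : (i < K)%N -> zpt R K i < zpt R K i.+1.
Proof.
move=> iK; have hpos := h0; have /andP[d0 d1] := theta_step iK.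
have /andP[t0 t1] := theta_itv i; have /andP[u0 u1] := theta_itv i.+1.
rewrite !zptE ltr_sqr ?nnegrE ?sin_ge0_pi//; try by (have := @pi_gt0 R; lra).
by rewrite ltr_sin ?in_itv/=; lra.
Qed.

Lemma zpt_mono i j : (i <= j <= K)%N -> zpt R K i <= zpt R K j.
Proof.
case/andP; elim: j => [|j IH]; first by rewrite leqn0 => /eqP ->.
rewrite leq_eqVlt => /orP[/eqP -> //|ij jK].
by rewrite (le_trans (IH _ (ltnW jK)))// ltW// zpt_step.
Qed.

(** The factor [m] cancels: [sin2_gap] and steps of at most [2 / K] bound the squared spacing by
    [64 m / K^2], which [round_excess] divides by [4 m]. *)
Lemma zpt_gap i y w :
  let z := zpt R K in
  let a := (z i.+1 - w) / (z i.+1 * (1 - z i.+1)) in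
  let b := (w - z i) / (z i * (1 - z i)) in
  (i < K)%N -> z i <= w < z i.+1 ->
  a / (a + b) * logloss (z i) y + b / (a + b) * logloss (z i.+1) y
    <= logloss w y + 16 / K%:R ^+ 2.
Proof.
move=> z a b iK /andP[zw wz].
have hpos := h0; have /andP[d0 d1] := theta_step iK.
have /andP[t0 t1] := theta_itv i; have /andP[u0 u1] := theta_itv i.+1.
have /andP[p0 p1] := zpt_itv i; have /andP[q0 q1] := zpt_itv i.+1.
pose m := Num.min (z i * (1 - z i)) (z i.+1 * (1 - z i.+1)).
have B0 : 0 < z i * (1 - z i) by rewrite mulr_gt0// subr_gt0.
have A0 : 0 < z i.+1 * (1 - z i.+1) by rewrite mulr_gt0// subr_gt0.
have m0 : 0 < m by rewrite lt_min B0.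
apply: (le_trans (@round_excess _ _ w m y p0 zw wz q1 m0 _ _)).
- by rewrite ge_min lexx.
- by rewrite ge_min lexx orbT.
rewrite lerD2l.
have dm : (z i.+1 - z i) ^+ 2 <= sin (theta i.+1 - theta i) ^+ 2 * (16 * m).
  have [||| ha hb] := @sin2_gap R (theta i) (theta i.+1); try lra.
  by rewrite /m minEle; case: ifP => _; rewrite /z !zptE.
have sd : sin (theta i.+1 - theta i) ^+ 2 <= (2 * K%:R^-1) ^+ 2.
  have s0 : 0 <= sin (theta i.+1 - theta i).
    by rewrite sin_ge0_pi//; have := @pi_gt0 R; lra.
  rewrite ler_sqr ?nnegrE ?mulr_ge0 ?invr_ge0 ?(ltW K0)//.
  have [hK _] := h_le; have := sin_le_id (ltW d0); lra.
rewrite ler_pdivrMr ?mulr_gt0//; apply: (le_trans dm).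
have := ler_wpM2r (ltW m0) sd.
have -> : (2 * K%:R^-1) ^+ 2 * m = 16 / K%:R ^+ 2 * (4 * m) / 16.
  by field; rewrite gt_eqF.
lra.
Qed.

Lemma zpt_bracket w : zpt R K 0 <= w < zpt R K K ->
  exists2 i, (i < K)%N & zpt R K i <= w < zpt R K i.+1.
Proof.
move=> /andP[z0w wzK].
have : forall k, (k <= K)%N -> w < zpt R K k ->
    exists2 i, (i < K)%N & zpt R K i <= w < zpt R K i.+1;
  last by move=> H; apply: (H K).
elim=> [|k IH] kK wk; first by move: z0w; rewrite leNgt wk.
have [zkw|wzk] := leP (zpt R K k) w; first by exists k => //; rewrite zkw.
by apply: IH => //; exact: ltnW.
Qed.

(** Monotonicity of the grid leaves one nonzero term in the sum defining [rround]. The Kronecker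
    deltas are the form that [sum_delta] consumes. *)
Lemma rround_inside w i j : (i < K)%N -> zpt R K i <= w < zpt R K i.+1 ->
  let z := zpt R K in
  let a := (z i.+1 - w) / (z i.+1 * (1 - z i.+1)) in
  let b := (w - z i) / (z i * (1 - z i)) in
  rround K w j = (j == i)%:R * (a / (a + b)) + (j == i.+1)%:R * (b / (a + b)).
Proof.
move=> iK /[dup] wi /andP[zw wz] z a b; rewrite /rround ltNge.
rewrite (le_trans (@zpt_mono 0 i _) zw) ?(ltnW iK)//=.
rewrite leNgt (lt_le_trans wz) ?zpt_mono ?iK//=.
rewrite (bigD1 (Ordinal iK))//= wi big1 ?addr0 => [|k].
  have [->|_] := eqVneq j i; first by rewrite mul1r (ltn_eqF (ltnSn i)) mul0r addr0.
  by rewrite mul0r add0r; case: eqP; rewrite ?mul1r ?mul0r.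
rewrite -val_eqE /= => ki; case: ifP => // /andP[zkw wzk]; exfalso.
have [lik|lki] := ltnP i k.
  by have := @zpt_mono i.+1 k; rewrite lik (ltnW (ltn_ord k)) => /(_ isT); lra.
have {ki}lki : (k < i)%N by rewrite ltn_neqAle ki.
by have := @zpt_mono k.+1 i; rewrite lki (ltnW iK) => /(_ isT); lra.
Qed.

(** Follows from [- ln (1 - x) <= x / (1 - x)] with [x <= 1/4]. At [x = sin h ^ 2], the distance of
    the grid ends from 0 and 1, it prices the clamping of forecasts outside the grid. *)
Lemma ln_endpoint x : 0 <= x -> x <= h ^+ 2 -> - ln (1 - x) <= 16 / K%:R ^+ 2.
Proof.
move=> x0 xh; have [hK h2] := h_le.
have hh : h ^+ 2 <= 4^-1.
  have -> : 4^-1 = 2^-1 ^+ 2 :> R by field.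
  by rewrite ler_sqr ?nnegrE// ltW.
have hk2 : h ^+ 2 <= K%:R^-1 ^+ 2 by rewrite ler_sqr ?nnegrE ?invr_ge0 ?(ltW h0) ?(ltW K0).
have x1 : 0 < 1 - x by lra.
rewrite -lnV ?posrE//; apply: (le_trans (ln_le_subr1 _)); first by rewrite invr_gt0.
have -> : (1 - x)^-1 - 1 = x / (1 - x) by field; rewrite gt_eqF.
rewrite ler_pdivrMr// -exprVn; have k0 := sqr_ge0 (K%:R^-1 : R).
by nra.
Qed.

Lemma rround_excess w y : 0 < w < 1 ->
  \sum_(j < K.+1) rround K w j * logloss (zpt R K j) y
    <= logloss w y + 16 / K%:R ^+ 2.
Proof.
move=> w01; have K16 : 0 <= 16 / K%:R ^+ 2 :> R by rewrite divr_ge0// exprn_ge0.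
have /andP[p0 p1] := zpt_itv 0; have /andP[q0 q1] := zpt_itv K.
have sh : sin h ^+ 2 <= h ^+ 2.
  have s0 : 0 <= sin h.
    by have hpos := h0; have /andP[? ?] := theta_itv 0; rewrite sin_ge0_pi//; have := @pi_gt0 R; lra.
  by rewrite ler_sqr ?nnegrE ?sin_le_id// ltW.
have z0E : zpt R K 0 = sin h ^+ 2 by rewrite hE.
have zKE : zpt R K K = 1 - sin h ^+ 2.
  by rewrite /zpt ltnn gtn_eqF ?(leq_trans _ K2)// -hE cos2sin2.
(* Below the grid, rounding up helps outcome 1, and under outcome 0 the whole loss of [z_0] is
   already small. Above the grid the roles swap. *)
have [wz0|z0w] := ltP w (zpt R K 0).
  under eq_bigr do rewrite /rround wz0.
  rewrite (@sum_delta _ _ (fun j => logloss (zpt R K j) y))//.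
  case: y; rewrite !loglossE /=.
  - by have : ln w <= ln (zpt R K 0); [rewrite ler_ln ?posrE//; lra|lra].
  - have := @ln_endpoint (zpt R K 0); rewrite z0E => /(_ (sqr_ge0 _) sh).
    by have : ln (1 - w) <= 0; [rewrite ln_le0//; lra|lra].
have [zKw|wzK] := leP (zpt R K K) w.
  under eq_bigr do rewrite /rround ltNge z0w /= zKw.
  rewrite (@sum_delta _ _ (fun j => logloss (zpt R K j) y))//.
  case: y; rewrite !loglossE /=.
  - have := ln_endpoint (sqr_ge0 (sin h)) sh; rewrite -zKE.
    by have : ln w <= 0; [rewrite ln_le0//; lra|lra].
  - by have : ln (1 - w) <= ln (1 - zpt R K K); [rewrite ler_ln ?posrE//; lra|lra].
have [|i iK wi] := @zpt_bracket w; first by rewrite z0w.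
apply: le_trans (zpt_gap y iK wi).
under eq_bigr do rewrite (rround_inside _ iK wi).
set a := (X in _ <= X * _ + _); set b := (X in _ <= _ + X * _).
have split2 : forall (j : 'I_K.+1),
    ((j == i :> nat)%:R * a + (j == i.+1 :> nat)%:R * b) * logloss (zpt R K j) y =
    (j == i :> nat)%:R * (a * logloss (zpt R K j) y)
    + (j == i.+1 :> nat)%:R * (b * logloss (zpt R K j) y) by move=> j; ring.
rewrite (eq_bigr _ (fun j _ => split2 j)) big_split/=.
rewrite (@sum_delta _ i (fun j => a * logloss (zpt R K j) y)) ?ltnS 1?ltnW//.
by rewrite (@sum_delta _ i.+1 (fun j => b * logloss (zpt R K j) y)) ?ltnS.
Qed.

End Grid.
End Rounding.

(** * From calibration error to column regrets *)

Section Calibration.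
Variables (R : realType) (T K : nat) (y : nat -> bool) (pi_ : nat -> nat -> R).
Hypotheses (K2 : (2 <= K)%N) (run : is_BMlog_run T K y pi_).

Lemma run_itv i t : (i <= K)%N -> (t < T)%N -> 0 <= pi_ t i <= 1.
Proof.
move=> iK tT; have [p0 p1 _] := run tT; rewrite p0//= -p1.
rewrite -ltnS in iK; rewrite (bigD1 (Ordinal iK))//= lerDl sumr_ge0// => j _.
by rewrite p0// -ltnS.
Qed.

Lemma KL_column i : (i <= K)%N ->
  let n := \sum_(t < T) pi_ t i in
  let a := \sum_(t < T) (nat_of_bool (y t))%:R * pi_ t i in
  \sum_(t < T) pi_ t i * KLb (rho T y pi_ i) (zpt R K i)
    = \sum_(t < T) pi_ t i * logloss (zpt R K i) (y t)
      + (a * ln (a / n) + (n - a) * ln (1 - a / n)).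
Proof.
move=> iK n a; have pi01 t := @run_itv i t iK.
have /andP[z0 z1] : 0 < zpt R K i < 1 := zpt_itv K2 erefl i.
set z := zpt R K i in z0 z1 *.
have /andP[a0 an] : 0 <= a <= n := hits_itv y pi01.
have n0 : 0 <= n by lra.
rewrite -mulr_suml -/n sum_logloss -/n -/a /rho -/n -/a.
have [nz|nn] := eqVneq n 0.
  have -> : a = 0 by lra.
  by rewrite nz !mul0r subrr !mul0r; lra.
have np : 0 < n by rewrite lt0r nn.
have r0 : 0 <= a / n by rewrite divr_ge0.
have r1 : a / n <= 1 by rewrite ler_pdivrMr// mul1r.
(* Splitting the quotient stays valid at [q = 0], where both sides are 0; this covers empirical
   means 0 and 1. *)
have lnq (q s : R) : 0 <= q -> 0 < s -> q * ln (q / s) = q * (ln q - ln s).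
  move=> q0 s0; have [->|qn] := eqVneq q 0; first by rewrite !mul0r.
  by rewrite ln_div ?posrE// lt0r qn.
rewrite /KLb (lnq (a / n))// (lnq (1 - a / n)); [|lra..].
by move: (ln (a / n)) (ln (1 - a / n)) (ln z) (ln (1 - z)) => *; field.
Qed.

(** Replacing [pi] by [Q pi] and exchanging sums gives the average over columns of the loss after
    rounding. [rround_excess] then applies in each column, and the weights sum to 1. *)
Lemma fixed_point_loss t : (t < T)%N ->
  \sum_(i < K.+1) pi_ t i * logloss (zpt R K i) (y t)
    <= \sum_(i < K.+1) pi_ t i * logloss (wbar y pi_ t i) (y t) + 16 / K%:R ^+ 2.
Proof.
move=> tT; have [p0 p1 fixp] := run tT.
have -> : \sum_(i < K.+1) pi_ t i * logloss (zpt R K i) (y t) =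
    \sum_(i < K.+1) pi_ t i *
      \sum_(j < K.+1) rround K (wbar y pi_ t i) j * logloss (zpt R K j) (y t).
  under [RHS]eq_bigr do rewrite mulr_sumr.
  rewrite exchange_big/=; apply: eq_bigr => j _.
  have jK : (j <= K)%N by rewrite -ltnS.
  by rewrite -(fixp j jK) mulr_suml; apply: eq_bigr => i _; rewrite [RHS]mulrCA mulrA.
have -> : 16 / K%:R ^+ 2 = \sum_(i < K.+1) pi_ t i * (16 / K%:R ^+ 2) :> R.
  by rewrite -mulr_suml p1 mul1r.
rewrite -big_split/=; apply: ler_sum => i _.
have iK : (i <= K)%N by rewrite -ltnS.
rewrite -mulrDr ler_wpM2l ?p0//.
apply: (rround_excess K2 erefl); apply: wbar_itv => tau tt.
by apply: run_itv => //; exact: ltn_trans tT.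
Qed.

Lemma PKLCal_bound :
  PKLCal T K y pi_ <= T%:R * (16 / K%:R ^+ 2) + K.+1%:R * (ln (T%:R + 1) + 1).
Proof.
rewrite /PKLCal.
pose n (i : nat) : R := \sum_(t < T) pi_ t i.
pose a (i : nat) : R := \sum_(t < T) (nat_of_bool (y t))%:R * pi_ t i.
(* [ent i] is minus the cumulative loss of the empirical mean in column [i]. *)
pose ent i := a i * ln (a i / n i) + (n i - a i) * ln (1 - a i / n i).
have iK (i : 'I_K.+1) : (i <= K)%N by rewrite -ltnS.
rewrite (eq_bigr _ (fun (i : 'I_K.+1) _ => KL_column (iK i))) big_split/=.
rewrite exchange_big/=.
apply: (@le_trans _ _ (\sum_(t < T) (\sum_(i < K.+1) pi_ t i * logloss (wbar y pi_ t i) (y t)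
   + 16 / K%:R ^+ 2) + \sum_(i < K.+1) ent i)).
  by rewrite lerD2r; apply: ler_sum => t _; exact: fixed_point_loss.
rewrite big_split/= exchange_big/= addrAC.
have -> : \sum_(t < T) 16 / K%:R ^+ 2 = T%:R * (16 / K%:R ^+ 2) :> R.
  by rewrite sumr_const card_ord [RHS]mulr_natl.
rewrite [leLHS]addrC lerD2l.
rewrite -big_split/=.
have -> : K.+1%:R * (ln (T%:R + 1) + 1) = \sum_(i < K.+1) (ln (T%:R + 1) + 1) :> R.
  by rewrite sumr_const card_ord mulr_natl.
apply: ler_sum => i _; have pi01 t := @run_itv i t (iK i).
apply: (le_trans (regret_column y pi01)).
have n0 : 0 <= n i := mass_ge0 pi01.
have nT : n i <= T%:R.
  have -> : T%:R = \sum_(t < T) 1 :> R by rewrite sumr_const card_ord.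
  by apply: ler_sum => t _; case/andP: (pi01 t (ltn_ord t)).
rewrite lerD2r ler_ln ?posrE -/(n i); lra.
Qed.

End Calibration.

(** * Choice of [K] and the final rate *)

Lemma Kchoice_itv (R : realType) (T : nat) (x : R) :
  x = (T%:R / ln T%:R) `^ 3%:R^-1 -> 1 <= x ->
  x / 2 <= (Kchoice R T)%:R <= 2 * x.
Proof.
move=> xE x1; rewrite /Kchoice -xE.
have /andP[tl tu] := truncn_itv (le_trans ler01 x1).
move: (Num.truncn x) tl tu => k tl tu.
have k1 : 1 <= k%:R :> R.
  rewrite ler1n lt0n; apply: contraTneq tu => ->; rewrite -leNgt//.
(* A floor that is at least 1 exceeds half of [x], and raising it to 2 stays below [2 * x] because
   [x >= 1]. *)
rewrite -natr1 in tu; rewrite /maxn; case: ltnP => k2; first by lra.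
have : k%:R <= 2 :> R by rewrite ler_nat.
lra.
Qed.

Theorem theorem2 :
  forall R : realType, exists C : R,
    forall T : nat, (3 <= T)%N ->
    forall (y : nat -> bool) (pi_ : nat -> nat -> R),
      is_BMlog_run T (Kchoice R T) y pi_ ->
      PKLCal T (Kchoice R T) y pi_
        <= C * ((T%:R : R) `^ (3%:R^-1)) * ((ln (T%:R : R)) `^ (2%:R / 3%:R)).
Proof.
(* The constant is 64 from the rounding term [b1] plus 16 from the regret term [b2]. *)
move=> R; exists 80 => T T3 y pi_ run.
have K2 : (2 <= Kchoice R T)%N by rewrite leq_maxl.
apply: (le_trans (@PKLCal_bound R T _ y pi_ K2 run)).
set K := Kchoice R T in K2 *.
have tr3 : 3 <= T%:R :> R by rewrite ler_nat.
set tt : R := T%:R in tr3 *.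
set L := ln tt.
have t0 : 0 < tt by lra.
(* This absorbs the additive 1 of the regret bound, as [1 <= 2 * L]. *)
have L2 : 2^-1 <= L.
  have := @ln_le_subr1 R tt^-1; rewrite invr_gt0 lnV ?posrE// => /(_ t0).
  have : tt^-1 <= 3^-1 by rewrite lef_pV2 ?posrE.
  rewrite -/L; lra.
have L0 : 0 < L by lra.
set x := (tt / L) `^ 3%:R^-1.
have q1 : 1 <= tt / L by rewrite ler_pdivlMr// mul1r ltW// ln_sublinear.
have x1 : 1 <= x.
  rewrite -(powRr0 (tt / L)) /x ler_powR// invr_ge0//.
(* In terms of [x] and [l] the fractional powers disappear: [T = (x l)^3], [ln T = l^3], and the
   target rate is [x l^3]. *)
pose l := L `^ 3%:R^-1.
have cube (u : R) : 0 <= u -> (u `^ 3%:R^-1) ^+ 3 = u.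
  by move=> u0; rewrite -powR_mulrn ?powR_ge0// -powRrM mulVf// powRr1.
have sE : tt `^ 3%:R^-1 = x * l.
  by rewrite /x /l -powRM ?ltW ?divr_gt0// divfK ?gt_eqF.
have lE : L `^ (2%:R / 3%:R) = l ^+ 2.
  by rewrite -powR_mulrn ?powR_ge0// -powRrM mulrC.
have l3 : l ^+ 3 = L by rewrite cube// ltW.
have tE : tt = (x * l) ^+ 3 by rewrite -sE cube// ltW.
have l0 : 0 < l by rewrite powR_gt0.
have /andP[Kl Ku] : x / 2 <= K%:R <= 2 * x := Kchoice_itv (erefl x) x1.
have k2 : 2 <= K%:R :> R by rewrite ler_nat.
rewrite sE lE.
have b1 : tt * (16 / K%:R ^+ 2) <= 64 * (x * l ^+ 3).
  have K2pos : 0 < K%:R ^+ 2 :> R by rewrite exprn_gt0//; lra.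
  rewrite [leLHS]mulrA ler_pdivrMr//.
  have h : x ^+ 2 / 4 <= K%:R ^+ 2.
    have -> : x ^+ 2 / 4 = (x / 2) ^+ 2 by field.
    by rewrite ler_sqr ?nnegrE//; lra.
  have c0 : 0 <= 64 * (x * l ^+ 3) by rewrite !mulr_ge0 ?exprn_ge0//; lra.
  apply: le_trans (ler_wpM2l c0 h).
  by rewrite [X in X * 16 <= _]tE; lra.
have b2 : K.+1%:R * (ln (tt + 1) + 1) <= 16 * (x * l ^+ 3).
  have h1 : ln (tt + 1) <= 2 * L.
    have -> : 2 * L = ln (tt ^+ 2) by rewrite lnXn// mulr_natl.
    by rewrite ler_ln ?posrE ?exprn_gt0//; [nra|lra].
  have h2 : K.+1%:R <= 4 * x by rewrite -natr1; lra.
  have -> : 16 * (x * l ^+ 3) = 4 * x * (4 * L) by rewrite -l3; ring.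
  apply: ler_pM => //; last lra.
  by rewrite addr_ge0// ln_ge0//; lra.
apply: (le_trans (lerD b1 b2)).
by rewrite le_eqVlt; apply/orP; left; apply/eqP; ring.
Qed.
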